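(* For every fixed constant $r>0$ there exists a constant $C$ depending only on $r$ such that the following holds. Let $\varepsilon>0$, let $P$ be a set of $n\ge 1$ points in $\mathbb{R}^2$, and let $\mathcal{F}$ be the family of all axis-parallel rectangles in $\mathbb{R}^2$ with aspect ratio bounded by $r$ that contain at least $\varepsilon n$ points of $P$. Then there exists a weak $\varepsilon$-net for $\mathcal{F}$ of size at most $C/\varepsilon$.
   Context: An axis-parallel rectangle in $\mathbb{R}^2$ is a set $F=[x_1,y_1]\times[x_2,y_2]$ with $x_i<y_i$; write $l_i(F)=y_i-x_i$. Its aspect ratio is bounded by $r$ if $l_i(F)/l_j(F)\le r$ for all $i,j\in\{1,2\}$. Given a set $P$ of $n$ points and a family $\mathcal{F}$ of sets each containing at least $\varepsilon n$ points of $P$, a weak $\varepsilon$-net for $\mathcal{F}$ is a set of points of $\mathbb{R}^2$ (not necessarily points of $P$) that meets every member of $\mathcal{F}$. *)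

(* Defs.v *)
From HB Require Import structures.
From mathcomp Require Import all_boot all_order all_algebra finmap.
From mathcomp Require Import boolp classical_sets reals.

Set Implicit Arguments.
Unset Strict Implicit.
Unset Printing Implicit Defensive.

Import Order.TTheory GRing.Theory Num.Theory.
Local Open Scope fset_scope.
Local Open Scope classical_set_scope.
Local Open Scope ring_scope.

(* Points of the plane are row vectors; in p 0 i the 0 is the row index. *)

Definition rectangle (R : realType) (x y : 'rV[R]_2) : set 'rV[R]_2 :=
  [set p : 'rV[R]_2 | forall i : 'I_2, x 0 i <= p 0 i <= y 0 i].

Definition side_length (R : realType) (x y : 'rV[R]_2) (i : 'I_2) : R :=
  y 0 i - x 0 i.

(* The corners x and y are determined by F because x 0 i < y 0 i. *)
Definition bounded_aspect_rectangle (R : realType) (r : R)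
    (F : set 'rV[R]_2) : Prop :=
  exists x y : 'rV[R]_2,
    [/\ forall i : 'I_2, x 0 i < y 0 i,
        F = rectangle x y &
        forall i j : 'I_2, side_length x y i / side_length x y j <= r].

Definition eps_heavy (R : realType) (eps : R) (P : {fset 'rV[R]_2})
    (F : set 'rV[R]_2) : Prop :=
  eps * #|` P|%:R <= #|` [fset p in P | p \in F]|%:R.

Definition heavy_rectangles (R : realType) (r eps : R)
    (P : {fset 'rV[R]_2}) : set (set 'rV[R]_2) :=
  [set F | bounded_aspect_rectangle r F /\ eps_heavy eps P F].

(* The first conjunct is the standing requirement that makes the notion
   meaningful for a family; N need not be a subset of P. *)
Definition weak_eps_net (R : realType) (eps : R) (P : {fset 'rV[R]_2})
    (FF : set (set 'rV[R]_2)) (N : {fset 'rV[R]_2}) : Prop :=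
  (forall F, FF F -> eps_heavy eps P F) /\
  (forall F, FF F -> exists2 p, p \in N & F p).

(* Main.v *)
Require Import Defs.
From HB Require Import structures.
From mathcomp Require Import all_boot all_order all_algebra finmap.
From mathcomp Require Import boolp classical_sets reals.
From mathcomp Require Import lra.

(** The net is built greedily.  Fix the threshold [t = eps * n] and a finite
    set [Q] of points, initially [P].  Among the traces [F `&` Q] of the
    rectangles [F] of the family that contain at least [t] points of [Q],
    let [A] be one of least sup-norm diameter [m].  If another such rectangle
    [F'] contains a point of [A], then its own trace has diameter at least [m],
    so its longer side is at least [m], and by the aspect ratio bound all its
    sides are at least [m / r].  Hence [F'] meets the cube of radius [m] about
    any point of [A] and is too wide to slip through a grid of mesh at most
    [m / r] drawn in that cube ([cube_grid_hits]): it contains one of the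
    boundedly many grid points.  So these grid points take care of all
    rectangles that meet [A] ([smallest_trace_net]), while the remaining ones
    lose no point when [A] is removed from [Q].  Each round pays a constant
    number [K] of net points for the removal of at least [t] points of [P],
    which gives at most [K * n / t = K / eps] net points ([greedy_net]).

    Working with the diameter of the trace rather than with the size of the
    rectangle is what makes a minimum exist: there are finitely many traces,
    whereas the side lengths of heavy rectangles may have an infimum that is
    not attained, or equal to 0. *)

Set Implicit Arguments.
Unset Strict Implicit.
Unset Printing Implicit Defensive.

Import Order.TTheory GRing.Theory Num.Theory.
Local Open Scope fset_scope.
Local Open Scope classical_set_scope.
Local Open Scope ring_scope.

Definition trace (T : choiceType) (Q : {fset T}) (F : set T) : {fset T} :=
  [fset p in Q | p \in F].

Lemma in_trace (T : choiceType) (Q : {fset T}) (F : set T) (p : T) :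
  (p \in trace Q F) = (p \in Q) && (p \in F).
Proof. by rewrite !inE. Qed.

(** One round of the construction is the hypothesis: a set [A] of at least [t]
    points of [Q] such that [K] points meet all heavy sets which meet [A].
    A heavy set disjoint from [A] stays heavy for [Q `\` A], so induction on
    the size of [Q] applies, and the cost [K] is charged to [A]. *)
Lemma greedy_net (R : realType) (T : choiceType) (FF : set (set T))
    (K : nat) (t : R) :
  0 < t ->
  (forall Q : {fset T},
     (exists2 F, FF F & t <= #|` trace Q F|%:R) ->
     exists A G : {fset T},
       [/\ (A `<=` Q)%fset, t <= #|` A|%:R, (#|` G| <= K)%N &
           forall F p, FF F -> t <= #|` trace Q F|%:R -> p \in A -> F p ->
             exists2 q, q \in G & F q]) ->
  forall Q : {fset T}, exists N : {fset T},
    #|` N|%:R * t <= K%:R * #|` Q|%:R /\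
    (forall F, FF F -> t <= #|` trace Q F|%:R -> exists2 q, q \in N & F q).
Proof.
move=> t0 step Q; have [n] := ubnP #|` Q|.
elim: n => // n IHn in Q *; rewrite ltnS => leQn.
have [hQ|noQ] := pselect (exists2 F, FF F & t <= #|` trace Q F|%:R); last first.
  exists fset0; split; first by rewrite cardfs0 mul0r mulr_ge0.
  by move=> F FFF hF; case: noQ; exists F.
have [A [G [sAQ tA GK GP]]] := step Q hQ.
have A0 : (0 < #|` A|)%N by rewrite -(ltr_nat R); exact: lt_le_trans tA.
have cardQ : #|` Q| = (#|` (Q `\` A)%fset| + #|` A|)%N.
  by rewrite cardfsDS // subnK // fsubset_leq_card.
have [|N [Nt NP]] := IHn (Q `\` A)%fset.
  by apply: leq_trans leQn; rewrite cardQ -addn1 leq_add2l.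
exists (G `|` N)%fset; split.
  apply: (@le_trans _ _ ((K%:R + #|` N|%:R) * t)).
    rewrite ler_pM2r // -natrD ler_nat.
    by rewrite (leq_trans (leq_card_fsetU _ _)) // leq_add2r.
  rewrite cardQ natrD mulrDl mulrDr addrC lerD //.
  by rewrite ler_wpM2l.
move=> F FFF hF.
have [[p pA Fp]|FA] := pselect (exists2 p, p \in A & F p).
  by have [q qG Fq] := GP F p FFF hF pA Fp; exists q => //; rewrite in_fsetU qG.
have traceQA : trace (Q `\` A)%fset F = trace Q F.
  apply/fsetP => p; rewrite !in_trace in_fsetD.
  case pF: (p \in F); rewrite ?andbF // !andbT.
  case pA: (p \in A) => //=; case: FA; exists p => //.
  exact: set_mem pF.
have [|q qN Fq] := NP F FFF; first by rewrite traceQA.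
by exists q => //; rewrite in_fsetU qN orbT.
Qed.

Lemma seq_argmin (R : realType) (T : eqType) (f : T -> R) (s : seq T) :
  s != [::] -> exists2 x, x \in s & forall y, y \in s -> f x <= f y.
Proof.
elim: s => // a s IHs _; have [->|s0] := eqVneq s [::].
  by exists a => [|y]; rewrite inE // => /eqP ->.
have [x xs xmin] := IHs s0; have [ax|xa] := leP (f a) (f x).
  exists a => [|y]; first exact: mem_head.
  by rewrite inE => /predU1P[->//|/xmin]; exact: le_trans.
exists x => [|y]; first by rewrite inE xs orbT.
by rewrite inE => /predU1P[->|/xmin//]; exact: ltW.
Qed.

(** A finite set has finitely many traces, so least ones exist even though the
    family [FF] may be infinite. *)
Lemma trace_argmin (R : realType) (T : choiceType) (f : {fset T} -> R)
    (FF : set (set T)) (Q : {fset T}) :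
  (exists F, FF F) ->
  exists2 F, FF F & forall F', FF F' -> f (trace Q F) <= f (trace Q F').
Proof.
move=> [F0 FF0].
pose s := [seq A <- enum_fset (fpowerset Q)
             | `[< exists2 F, FF F & A = trace Q F >]].
have ins F : FF F -> trace Q F \in s.
  move=> FFF; rewrite mem_filter; apply/andP; split.
    by apply/asboolP; exists F.
  by rewrite fpowersetE; apply/fsubsetP => p; rewrite in_trace => /andP[].
have [|A As Amin] := @seq_argmin _ _ f s.
  by apply/eqP => s0; move: (ins _ FF0); rewrite s0.
move: (As); rewrite mem_filter => /andP[/asboolP[F FFF AF] _].
by exists F => // F' /ins /Amin; rewrite AF.
Qed.

Section Cubes.
Variables (R : realType) (d : nat).
Implicit Types (A : {fset 'rV[R]_d}) (p q c : 'rV[R]_d).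

Definition diameter A : R :=
  \big[Num.max/0]_(p <- A) \big[Num.max/0]_(q <- A)
    \big[Num.max/0]_(i < d) `|p 0 i - q 0 i|.

Lemma diameter_ge0 A : 0 <= diameter A.
Proof. exact: bigmax_ge_id. Qed.

Lemma dist_le_diameter A p q i :
  p \in A -> q \in A -> `|p 0 i - q 0 i| <= diameter A.
Proof.
move=> pA qA; apply: (@bigmax_sup_seq _ _ _ _ _ p) => //.
apply: (@bigmax_sup_seq _ _ _ _ _ q) => //.
exact: (le_bigmax _ (fun i => `|p 0 i - q 0 i|)).
Qed.

Lemma diameter_le A b : 0 <= b ->
  (forall p q i, p \in A -> q \in A -> `|p 0 i - q 0 i| <= b) ->
  diameter A <= b.
Proof.
move=> b0 hb; rewrite /diameter big_seq; apply: bigmax_le => // p pA.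
rewrite big_seq; apply: bigmax_le => // q qA.
by apply: bigmax_le => // i _; exact: hb.
Qed.

Definition grid_point c (m : R) (k : nat)
    (f : {ffun 'I_d -> 'I_(2 * k).+1}) : 'rV[R]_d :=
  \row_i (c 0 i - m + m / k%:R * (f i)%:R).

(** The [2 * k] steps of length [m / k] lead in each coordinate from one face
    of the cube of center [c] and radius [m] to the opposite one.  For [m = 0],
    which happens when a trace is a single point, only [c] is left. *)
Definition cube_grid c (m : R) (k : nat) : {fset 'rV[R]_d} :=
  [fset grid_point c m f | f in {: {ffun 'I_d -> 'I_(2 * k).+1}}].

Lemma card_cube_grid c m k : (#|` cube_grid c m k| <= (2 * k).+1 ^ d)%N.
Proof.
rewrite (leq_trans (leq_imfset_card _ _ _)) //=.
by rewrite -cardE card_ffun !card_ord.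
Qed.

End Cubes.

(** The first point of the progression that is not below [u] is at most [v]:
    its predecessor is below [u], and one step is no longer than [v - u]. *)
Lemma progression_hits (R : realType) (a h u v z : R) (n : nat) :
  h <= v - u -> u <= z <= v -> a <= z <= a + h * n%:R ->
  exists2 j, (j <= n)%N & u <= a + h * j%:R <= v.
Proof.
move=> huv /andP[uz zv] /andP[az zn].
have ex : exists j, u <= a + h * j%:R by exists n; exact: le_trans zn.
case: (ex_minnP ex) => j uj jmin; exists j.
  by apply: jmin; exact: le_trans zn.
rewrite uj /=; case: j => [|j] in uj jmin *.
  by rewrite mulr0 addr0 (le_trans az).
have : a + h * j%:R < u.
  by rewrite ltNge; apply/negP => /jmin; rewrite ltnn.
by rewrite -natr1; lra.
Qed.

(** A box that reaches into the cube and whose sides are all at least the mesh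
    cannot avoid the grid: a coordinate of a grid point can be chosen
    independently of the others, so this is [progression_hits] per coordinate. *)
Lemma cube_grid_hits (R : realType) (c x y p : 'rV[R]_2) (m : R) (k : nat) :
  (0 < k)%N -> (forall i, m / k%:R <= side_length x y i) ->
  rectangle x y p -> (forall i, `|p 0 i - c 0 i| <= m) ->
  exists2 q, q \in cube_grid c m k & rectangle x y q.
Proof.
move=> k0 side Fp pc.
have kn0 : k%:R != 0 :> R by rewrite pnatr_eq0 -lt0n.
have hit i : exists j : 'I_(2 * k).+1,
    x 0 i <= c 0 i - m + m / k%:R * j%:R <= y 0 i.
  have [|j jk hj] := @progression_hits _ (c 0 i - m) _ _ _ (p 0 i) (2 * k)
    (side i) (Fp i).
    have -> : m / k%:R * (2 * k)%:R = 2 * m.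
      by rewrite natrM mulrCA mulfVK.
    by have := pc i; rewrite ler_norml => /andP[]; lra.
  by exists (Ordinal (jk : (j < (2 * k).+1)%N)).
have [f hf] := choice hit.
exists (grid_point c m [ffun i => f i]).
  by apply/imfsetP; exists [ffun i => f i].
by move=> i; rewrite mxE ffunE.
Qed.

(** Two points of a rectangle differ in coordinate [i] by at most its [i]-th
    side, which is at most [r] times any other side. *)
Lemma diameter_trace_le (R : realType) (r : R) (x y : 'rV[R]_2)
    (Q : {fset 'rV[R]_2}) :
  (forall i, x 0 i < y 0 i) ->
  (forall i j, side_length x y i / side_length x y j <= r) ->
  forall j, diameter (trace Q (rectangle x y)) <= r * side_length x y j.
Proof.
move=> xy ratio j.
have side0 i : 0 < side_length x y i by rewrite subr_gt0.
have sider i : side_length x y i <= r * side_length x y j.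
  by rewrite -ler_pdivrMr.
apply: diameter_le => [|p q i]; first exact: le_trans (ltW (side0 j)) (sider j).
rewrite !in_trace => /andP[_ /set_mem Fp] /andP[_ /set_mem Fq].
have /andP[xp py] := Fp i; have /andP[xq qy] := Fq i.
apply: le_trans (sider i); rewrite /side_length ler_norml.
by apply/andP; split; lra.
Qed.

(** The round needed by [greedy_net].  Minimality of the diameter of [A] bounds
    from below the sides of every other heavy rectangle, so that a grid of mesh
    [diameter A / k] about an arbitrary point of [A] hits all those that
    meet [A]. *)
Lemma smallest_trace_net (R : realType) (r t : R) (k : nat)
    (Q : {fset 'rV[R]_2}) :
  0 < t -> (0 < k)%N -> r <= k%:R ->
  (exists2 F, bounded_aspect_rectangle r F & t <= #|` trace Q F|%:R) ->
  exists A G : {fset 'rV[R]_2},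
    [/\ (A `<=` Q)%fset, t <= #|` A|%:R, (#|` G| <= (2 * k).+1 ^ 2)%N &
        forall F p, bounded_aspect_rectangle r F -> t <= #|` trace Q F|%:R ->
          p \in A -> F p -> exists2 q, q \in G & F q].
Proof.
move=> t0 k0 rk [F0 rF0 tF0].
have [|F [rF tF] Fmin] := @trace_argmin _ _ (@diameter R 2)
    [set F | bounded_aspect_rectangle r F /\ t <= #|` trace Q F|%:R] Q.
  by exists F0.
set A := trace Q F in tF Fmin *.
have /fset0Pn[c cA] : A != fset0.
  by rewrite -cardfs_gt0 -(ltr_nat R); exact: lt_le_trans tF.
exists A, (cube_grid c (diameter A) k); split=> //.
- by apply/fsubsetP => p; rewrite in_trace => /andP[].
- exact: card_cube_grid.
move=> F' p rF' tF' pA F'p.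
have := Fmin F' (conj rF' tF').
case: rF' F'p => x [y [xy -> ratio]] xyp minA.
apply: (cube_grid_hits k0 _ xyp) => i; last exact: dist_le_diameter.
rewrite ler_pdivrMr ?ltr0n // mulrC.
apply: le_trans minA (le_trans (diameter_trace_le _ xy ratio i) _).
by rewrite ler_wpM2r // ltW // subr_gt0.
Qed.

Theorem corollary1p12 (R : realType) (r : R) (hr : 0 < r) :
  exists C : R,
    forall (eps : R) (P : {fset 'rV[R]_2}),
      0 < eps -> (1 <= #|` P|)%N ->
      exists N : {fset 'rV[R]_2},
        weak_eps_net eps P (heavy_rectangles r eps P) N /\
        #|` N|%:R <= C / eps.
Proof.
pose k := (Num.truncn r).+1.
have rk : r <= k%:R by apply: ltW; exact: truncnS_gt.
exists ((2 * k).+1 ^ 2)%:R => eps P eps0 P0.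
have n0 : 0 < #|` P|%:R :> R by rewrite ltr0n.
have t0 : 0 < eps * #|` P|%:R by rewrite mulr_gt0.
have [N [cardN hitN]] := greedy_net t0
  (fun Q => @smallest_trace_net R r _ k Q t0 isT rk) P.
exists N; split; last by rewrite ler_pdivlMr // -(ler_pM2r n0) -mulrA.
by split=> F [rF heavyF] //; exact: hitN.
Qed.
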